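(* For every integer $n\ge 1$, the monoid $\mathcal M_n(\mathbb{ST})$ of $n\times n$ supertropical matrices satisfies a nontrivial semigroup identity.
   Context: **Supertropical semiring.** $\mathbb{ST}=\mathbb R\cup\{-\infty\}\cup\mathbb R^\nu$ is the disjoint union of two copies of $\mathbb R$ together with the zero element $-\infty$; elements of $\mathbb R^\nu$ are written $a^\nu$, $a\in\mathbb R$. The map $\nu:\mathbb{ST}\to\mathbb R^\nu\cup\{-\infty\}$ is given by $\nu(a)=\nu(a^\nu)=a^\nu$ for $a\in\mathbb R$ and $\nu(-\infty)=-\infty$. The total order is $-\infty<a<a^\nu<b<b^\nu$ for all real $a<b$. Addition: $x\vee y=\max\{x,y\}$ if $\nu(x)\neq\nu(y)$, and $x\vee y=\nu(x)$ if $\nu(x)=\nu(y)$. Multiplication: $x\cdot y$ is the usual sum $x+y$ if $x,y\in\mathbb R$; otherwise it is the sum of $\nu(x)$ and $\nu(y)$, where $a^\nu+b^\nu=(a+b)^\nu$ and $-\infty$ is absorbing. The multiplicative identity is $0\in\mathbb R$. $\mathcal M_n(\mathbb{ST})$ is the multiplicative monoid of $n\times n$ matrices over $\mathbb{ST}$. **Identities.** $\{a,b\}^+$ is the free semigroup of nonempty words in $a,b$. A nontrivial semigroup identity is a pair $\langle u,v\rangle$ of words $u\ne v$ in $\{a,b\}^+$. A semigroup $\mathcal S$ satisfies it if $\phi(u)=\phi(v)$ for every semigroup homomorphism $\phi:\{a,b\}^+\to\mathcal S$, i.e. if for all $s,t\in\mathcal S$ the substitution $a\mapsto s$, $b\mapsto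 t$ gives $u$ and $v$ the same value in $\mathcal S$. *)

(* Defs.v *)
From HB Require Import structures.
From mathcomp Require Import all_boot all_order all_algebra.
From mathcomp Require Import reals.

Set Implicit Arguments.
Unset Strict Implicit.
Unset Printing Implicit Defensive.

Import Order.TTheory GRing.Theory Num.Theory.

Local Open Scope ring_scope.

(* The supertropical semiring R `|` {-oo} `|` R^nu over the reals R.          *)
(*    NInf == the zero element -oo                                            *)
(*   Tan a == a, in the first (tangible) copy of R                            *)
(* Ghost a == a^nu, in the second (ghost) copy of R                           *)
Inductive supertrop (R : realType) : Type :=
  | NInf
  | Tan of R
  | Ghost of R.

Arguments NInf {R}.

Section SupertropCode.
Variable R : realType.

Definition st_code (x : supertrop R) : option (R + R) :=
  match x with
  | NInf => None
  | Tan a => Some (inl a)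
  | Ghost a => Some (inr a)
  end.

Definition st_decode (c : option (R + R)) : supertrop R :=
  match c with
  | None => NInf
  | Some (inl a) => Tan a
  | Some (inr a) => Ghost a
  end.

Lemma st_codeK : cancel st_code st_decode.
Proof. by case. Qed.

End SupertropCode.

HB.instance Definition _ (R : realType) :=
  Choice.copy (supertrop R) (can_type (@st_codeK R)).

Fact st_display : Order.disp_t.
Proof. exact: (Order.Disp tt tt). Qed.

Section Supertrop.
Variable R : realType.
Implicit Types x y z : supertrop R.

(* -oo < a < a^nu < b < b^nu for all a < b in R *)
Definition st_le x y : bool :=
  match x, y with
  | NInf, _ => true
  | _, NInf => false
  | Tan a, Tan b | Tan a, Ghost b | Ghost a, Ghost b => a <= b
  | Ghost a, Tan b => a < b
  end.

Lemma st_le_refl : reflexive st_le.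
Proof. by case=> /=. Qed.

Lemma st_le_anti : antisymmetric st_le.
Proof.
move=> [|a|a] [|b|b] //= /andP[ab ba].
- by congr Tan; apply: le_anti; rewrite ab.
- by move: (le_lt_trans ab ba); rewrite ltxx.
- by move: (lt_le_trans ab ba); rewrite ltxx.
- by congr Ghost; apply: le_anti; rewrite ab.
Qed.

Lemma st_le_trans : transitive st_le.
Proof.
move=> [|b|b] [|a|a] [|c|c] //= ab bc.
- exact: le_trans ab bc.
- exact: le_trans ab bc.
- exact: lt_le_trans ab bc.
- exact: ltW (lt_le_trans ab bc).
- exact: ltW (le_lt_trans ab bc).
- exact: le_trans ab bc.
- exact: le_lt_trans ab bc.
- exact: le_trans ab bc.
Qed.

Lemma st_le_total : total st_le.
Proof.
move=> [|a|a] [|b|b] //=.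
- exact: le_total.
- by case: leP.
- by case: ltP.
- exact: le_total.
Qed.

HB.instance Definition _ := Order.Le_isPOrder.Build st_display (supertrop R)
  st_le_refl st_le_anti st_le_trans.

HB.instance Definition _ :=
  Order.POrder_isTotal.Build st_display (supertrop R) st_le_total.

Definition st_nu x : supertrop R :=
  match x with
  | NInf => NInf
  | Tan a | Ghost a => Ghost a
  end.

Definition st_add x y : supertrop R :=
  if st_nu x == st_nu y then st_nu x else Order.max x y.

(* The sum on R^nu `|` {-oo}, the range of st_nu; the junk value on tangible  *)
(* arguments is never used.                                                   *)
Definition st_ghost_mul x y : supertrop R :=
  match x, y with
  | Ghost a, Ghost b => Ghost (a + b)
  | _, _ => NInf
  end.

Definition st_mul x y : supertrop R :=
  match x, y with
  | Tan a, Tan b => Tan (a + b)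
  | _, _ => st_ghost_mul (st_nu x) (st_nu y)
  end.

Lemma st_leE x y : (x <= y)%O = st_le x y.
Proof. by []. Qed.

Lemma Ghost_eqE (a b : R) : (Ghost a == Ghost b) = (a == b).
Proof. by apply/eqP/eqP=> [[]|->]. Qed.

Lemma st_add0 : left_id NInf st_add.
Proof. by case=> [|a|a] //; rewrite /st_add /= maxEle st_leE. Qed.

Lemma st_addC : commutative st_add.
Proof.
move=> x y; rewrite /st_add eq_sym; case: eqP => [->//|_]; exact: maxC.
Qed.

(* A non-zero element is determined by its copy and its underlying real. *)
Definition st_mk (g : bool) (a : R) : supertrop R :=
  if g then Ghost a else Tan a.

Lemma st_mkP x : x = NInf \/ exists g a, x = st_mk g a.
Proof.
case: x => [|a|a]; [by left|right; exists false, a | right; exists true, a].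
- by [].
- by [].
Qed.

Lemma st_add_mk g h (a b : R) : st_add (st_mk g a) (st_mk h b) =
  if a < b then st_mk h b else if b < a then st_mk g a else st_mk true a.
Proof.
have nu_mk k c : st_nu (st_mk k c) = Ghost c by case: k.
rewrite /st_add !nu_mk Ghost_eqE maxEle st_leE.
have [ab|ba|-> //] := ltgtP a b.
- suff -> : st_le (st_mk g a) (st_mk h b) by [].
  by case: g h => -[] /=; rewrite ?ab // ltW.
- suff /negPf-> : ~~ st_le (st_mk g a) (st_mk h b) by [].
  by case: g h => -[] /=; rewrite -?leNgt -?ltNge // ltW.
Qed.

Lemma st_addA : associative st_add.
Proof.
have add0 := st_add0; have addr0 x : st_add x NInf = x by rewrite st_addC st_add0.
move=> x y z.
have [->|[g [a ->]]] := st_mkP x; first by rewrite !add0.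
have [->|[h [b ->]]] := st_mkP y; first by rewrite add0 addr0.
have [->|[k [c ->]]] := st_mkP z; first by rewrite !addr0.
rewrite (st_add_mk h k) (st_add_mk g h).
have [ab|ba|ab] := ltgtP a b; have [bc|cb|bc] := ltgtP b c;
  rewrite ?ab ?bc !st_add_mk.
- by rewrite (lt_trans ab bc) bc.
- by rewrite ab (lt_gtF cb) cb.
- by rewrite -bc ab ltxx.
- by [].
- by rewrite (lt_gtF ba) ba (lt_gtF (lt_trans cb ba)) (lt_trans cb ba).
- by rewrite -bc (lt_gtF ba) ba.
- by rewrite bc.
- by rewrite ltxx (lt_gtF cb) cb.
- by rewrite ltxx.
Qed.

Lemma st_mulC : commutative st_mul.
Proof. by case=> [|a|a] [|b|b] //=; rewrite addrC. Qed.

Lemma st_mulA : associative st_mul.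
Proof. by case=> [|a|a] [|b|b] [|c|c] //=; rewrite addrA. Qed.

Lemma st_mul1 : left_id (Tan 0) st_mul.
Proof. by case=> [|a|a] //=; rewrite add0r. Qed.

Lemma st_mul0 : left_zero NInf st_mul.
Proof. by case. Qed.

Lemma st_mul_mk g h (a b : R) :
  st_mul (st_mk g a) (st_mk h b) = st_mk (g || h) (a + b).
Proof. by case: g h => -[]. Qed.

Lemma st_mulDl : left_distributive st_mul st_add.
Proof.
have addr0 x : st_add x NInf = x by rewrite st_addC st_add0.
have mulr0 x : st_mul x NInf = NInf by rewrite st_mulC st_mul0.
move=> x y z.
have [->|[k [c ->]]] := st_mkP z; first by rewrite !mulr0 st_add0.
have [->|[g [a ->]]] := st_mkP x; first by rewrite st_mul0 !st_add0.
have [->|[h [b ->]]] := st_mkP y; first by rewrite st_mul0 !addr0.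
rewrite !st_mul_mk !st_add_mk !ltrD2r.
by case: ltgtP => _; rewrite st_mul_mk.
Qed.

Lemma st_one_neq0 : Tan 0 != NInf :> supertrop R.
Proof. by []. Qed.

HB.instance Definition _ :=
  GRing.isNmodule.Build (supertrop R) st_addA st_addC st_add0.

HB.instance Definition _ := GRing.Nmodule_isComNzSemiRing.Build (supertrop R)
  st_mulA st_mulC st_mul1 st_mulDl st_mul0 st_one_neq0.

End Supertrop.

(* An alias of 'M[S]_n carrying the monoid structure (mulmx, 1%:M); 'M[S]_n    *)
(* itself only has a semiring structure.                                       *)
Definition mxmonoid (S : pzSemiRingType) (n : nat) : Type := 'M[S]_n.

HB.instance Definition _ (S : pzSemiRingType) (n : nat) :=
  Choice.on (mxmonoid S n).

HB.instance Definition _ (S : pzSemiRingType) (n : nat) :=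
  isMonoid.Build (mxmonoid S n)
    (@mulmxA S n n n n) (@mul1mx S n n) (@mulmx1 S n n).

(* The free semigroup A^+: the empty word is excluded. *)
Definition words (A : choiceType) : Type := {w : seq A | w != [::]}.

HB.instance Definition _ (A : choiceType) := Choice.on (words A).

Lemma words_cat_subproof (A : choiceType) (u v : words A) :
  val u ++ val v != [::].
Proof. by case: u => -[]. Qed.

Definition words_cat (A : choiceType) (u v : words A) : words A :=
  exist _ (val u ++ val v) (words_cat_subproof u v).

Lemma words_catA (A : choiceType) : associative (@words_cat A).
Proof. by move=> u v w; apply: val_inj; rewrite /= catA. Qed.

HB.instance Definition _ (A : choiceType) :=
  isSemigroup.Build (words A) (@words_catA A).

(* Two-letter words are taken over bool, true and false standing for a and b. *)
Definition satisfies_identity (S : semigroupType) (u v : words bool) : Prop :=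
  forall phi : {multiplicative words bool -> S}, phi u = phi v.

(* Main.v *)
Require Import Defs.
From HB Require Import structures.
From mathcomp Require Import all_boot all_order all_algebra.
From mathcomp Require Import fingroup perm cyclic.
From mathcomp Require Import reals.
From mathcomp Require Import zify ring.

Set Implicit Arguments.
Unset Strict Implicit.
Unset Printing Implicit Defensive.

Import Order.TTheory GRing.Theory Num.Theory.

(** The identity is first built for matrices over the max-plus semiring, where
    an entry of a product is the optimal weight of a walk, and then carried over
    to supertropical matrices.

    The max-plus case is an induction on the size N of the matrices, resting on
    a dichotomy between nonsingular matrices, whose permanent is attained by a
    single permutation ([dominant]), and singular ones.

    If A is singular, a power of A of exponent depending on N only factors
    through dimension N - 1 ([singular_pow_factors]). Put X = A ^+ N`!. In a long
    walk some cycle length occurs so often that all cycles of this length may be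
    replaced by copies of the best of them, whose total length is a multiple of
    N`!; repeating this, every long walk in X becomes optimal while spending all
    but a bounded number of its steps on a loop at one node
    ([pow_concentrates]). If at some node k loops can be replaced by an excursion
    to another node without loss, no optimal walk has to be at k at a chosen
    step, and X ^+ T = X ^+ M * X ^+ (T - M) remains true without the
    intermediate node k. If there is no such k, then loops beat all other cycles,
    so X, and hence A, is nonsingular.

    If a product is nonsingular, so are its factors, and the dominant
    permutations multiply ([dominantM]), because two optimal walks which meet
    could exchange their ends. For factors A ^+ N`! and B ^+ N`! the dominant
    permutations are trivial, so the diagonal entries multiply and no closed walk
    is heavier than the constant one. Optimal walks then need fewer than N steps
    changing the node, called jumps ([few_jumps]). The words [swap_words]
    cannot be told apart by walks with few jumps: they are obtained by iterating
    the pair x y x y x y, x y y x x y, in which a block containing all the jumps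
    may be shifted to the left or to the right, one of these directions being
    favourable, up to the outermost occurrence of its letter, and the outermost
    occurrences are the same in both words ([swap_eq_upto]).

    Let p and q be these words in a ^ N`! and b ^ N`!, with values P and Q, let z
    be a product of high powers of p and q, with value Z, and let u, v, of the
    same length, be an identity in dimension N - 1. Then u(z p, z q) z and v(z p, z q) z form an
    identity in dimension N: if P and Q are nonsingular then P = Q, and
    otherwise Z factors through dimension N - 1 ([trop_identity_step]).

    A supertropical entry is determined by its weight and by whether it is
    tangible. It fails to be tangible when the optimal weight is attained by two
    walks or by a walk using a ghost entry, that is, when some pair of optimal
    walks is not formed of two copies of one tangible walk. Pairs of walks are
    the walks of a larger max-plus matrix with n + n ^ 2 nodes, so that an
    identity in this dimension settles both questions
    ([supertrop_identity]). *)

(** * The max-plus semiring *)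

(** [None] is the zero element -oo, [Some a] the real number [a]. *)
Definition trop (R : realDomainType) : Type := option R.

HB.instance Definition _ (R : realDomainType) := Choice.on (trop R).

Section TropStructure.
Local Open Scope ring_scope.
Variable R : realDomainType.
Implicit Types x y z : trop R.

Definition trop_le x y : bool :=
  match x, y with
  | None, _ => true
  | Some _, None => false
  | Some a, Some b => a <= b
  end.

Lemma trop_le_refl : reflexive trop_le.
Proof. by case=> /=. Qed.

Lemma trop_le_anti : antisymmetric trop_le.
Proof. by move=> [a|] [b|] //= ab; rewrite (le_anti ab). Qed.

Lemma trop_le_trans : transitive trop_le.
Proof. by move=> [b|] [a|] [c|] //=; apply: le_trans. Qed.

Lemma trop_le_total : total trop_le.
Proof. by move=> [a|] [b|] //=; apply: le_total. Qed.

HB.instance Definition _ := Order.Le_isPOrder.Build ring_display (trop R)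
  trop_le_refl trop_le_anti trop_le_trans.

HB.instance Definition _ :=
  Order.POrder_isTotal.Build ring_display (trop R) trop_le_total.

Definition trop_add x y : trop R := Order.max x y.

Definition trop_mul x y : trop R :=
  match x, y with
  | Some a, Some b => Some (a + b)
  | _, _ => None
  end.

Lemma trop_leE x y : (x <= y) = trop_le x y.
Proof. by []. Qed.

Lemma trop_addA : associative trop_add.
Proof. exact: maxA. Qed.

Lemma trop_addC : commutative trop_add.
Proof. exact: maxC. Qed.

Lemma trop_add0 : left_id None trop_add.
Proof. by move=> x; rewrite /trop_add maxEle. Qed.

Lemma trop_mulA : associative trop_mul.
Proof. by move=> [a|] [b|] [c|] //=; rewrite addrA. Qed.

Lemma trop_mulC : commutative trop_mul.
Proof. by move=> [a|] [b|] //=; rewrite addrC. Qed.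

Lemma trop_mul1 : left_id (Some 0) trop_mul.
Proof. by move=> [a|] //=; rewrite add0r. Qed.

Lemma trop_mulD : left_distributive trop_mul trop_add.
Proof.
move=> [a|] [b|] [c|]; rewrite /trop_add !maxEle ?trop_leE //=.
  by rewrite lerD2r; case: ifP.
by case: ifP.
Qed.

Lemma trop_mul0 : left_zero None trop_mul.
Proof. by []. Qed.

Lemma trop_one_neq0 : Some 0 != None :> trop R.
Proof. by []. Qed.

HB.instance Definition _ := GRing.isNmodule.Build (trop R)
  trop_addA trop_addC trop_add0.

HB.instance Definition _ := GRing.Nmodule_isComNzSemiRing.Build (trop R)
  trop_mulA trop_mulC trop_mul1 trop_mulD trop_mul0 trop_one_neq0.

End TropStructure.

Section TropTheory.
Local Open Scope ring_scope.
Variable R : realDomainType.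
Implicit Types x y z t : trop R.

Lemma tropD x y : x + y = Order.max x y.
Proof. by []. Qed.

Lemma trop_ge0 x : (0 : trop R) <= x.
Proof. by []. Qed.

Lemma trop_gt0 x : ((0 : trop R) < x) = (x != 0).
Proof. by rewrite lt_neqAle eq_sym trop_ge0 andbT. Qed.

Lemma trop_mul_eq0 x y : (x * y == 0) = (x == 0) || (y == 0).
Proof. by case: x y => [a|] [b|]. Qed.

Lemma trop_leM x y z t : x <= y -> z <= t -> x * z <= y * t.
Proof. by move: x y z t => [a|] [b|] [c|] [d|] //; apply: lerD. Qed.

Lemma trop_ltM2r z x y : z != 0 -> x < y -> x * z < y * z.
Proof.
by move: z x y => [c|] [a|] [b|] // _; rewrite !ltNge !trop_leE /= lerD2r.
Qed.

Lemma trop_ltM x y z t : x < y -> z < t -> x * z < y * t.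
Proof.
move=> xy zt; have [->|z0] := eqVneq z 0.
  rewrite mulr0 trop_gt0 trop_mul_eq0 negb_or -!trop_gt0.
  by rewrite (le_lt_trans (trop_ge0 x) xy) (le_lt_trans (trop_ge0 z) zt).
apply: lt_le_trans (trop_ltM2r z0 xy) _.
by apply: trop_leM => //; apply: ltW.
Qed.

Lemma trop_ltMl x y z t : x < y -> z <= t -> t != 0 -> x * z < y * t.
Proof.
move=> xy zt t0; apply: le_lt_trans (trop_ltM2r t0 xy).
exact: trop_leM.
Qed.

Lemma trop_leX x y k : x <= y -> x ^+ k <= y ^+ k.
Proof.
by move=> xy; elim: k => // k IH; rewrite !exprS; apply: trop_leM.
Qed.

Lemma trop_exp_neq0 x k : x != 0 -> x ^+ k != 0.
Proof.
by move=> x0; elim: k => // k IH; rewrite exprS trop_mul_eq0 negb_or x0.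
Qed.

Lemma trop_prod_neq0 (I : Type) (r : seq I) (P : pred I) (F : I -> trop R) :
  (forall i, P i -> F i != 0) -> \prod_(i <- r | P i) F i != 0.
Proof.
move=> F0; elim/big_rec: _ => // i x Pi x0.
by rewrite trop_mul_eq0 negb_or F0.
Qed.

Lemma trop_prod_neq0P (I : finType) (F : I -> trop R) (i : I) :
  \prod_i F i != 0 -> F i != 0.
Proof. by rewrite (bigD1 i) //= trop_mul_eq0 negb_or => /andP[]. Qed.

Lemma trop_le_prod (I : Type) (r : seq I) (P : pred I) (F G : I -> trop R) :
  (forall i, P i -> F i <= G i) ->
  \prod_(i <- r | P i) F i <= \prod_(i <- r | P i) G i.
Proof.
by move=> FG; elim/big_ind2: _ => // *; apply: trop_leM.
Qed.

Lemma trop_lt_prod (I : finType) (F G : I -> trop R) (i0 : I) :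
  (forall i, F i <= G i) -> (forall i, G i != 0) -> F i0 < G i0 ->
  \prod_i F i < \prod_i G i.
Proof.
move=> FG G0 lt0; rewrite (bigD1 i0) //= [ltRHS](bigD1 i0) //=.
apply: trop_ltMl => //; first exact: trop_le_prod.
exact: trop_prod_neq0.
Qed.

(** Non-zero factors can be cancelled, so one strict inequality between factors
    would make the products differ. In this way optimality of a total weight is
    inherited by its parts. *)
Lemma trop_prod_le_eq (I : finType) (F G : I -> trop R) :
  (forall i, F i <= G i) -> (forall i, F i != 0) ->
  \prod_i G i <= \prod_i F i -> forall i, F i = G i.
Proof.
move=> FG F0 le i; apply/eqP; rewrite eq_le FG /= leNgt.
apply/negP => lti; suff: \prod_i F i < \prod_i G i by rewrite ltNge le.
apply: (trop_lt_prod FG _ lti) => j.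
by rewrite -trop_gt0 (lt_le_trans _ (FG j)) ?trop_gt0.
Qed.

Lemma trop_sum_ub (I : finType) (P : pred I) (F : I -> trop R) i :
  P i -> F i <= \sum_(i | P i) F i.
Proof. by move=> Pi; rewrite (bigD1 i) //= tropD le_max lexx. Qed.

Lemma trop_sum_le (I : Type) (r : seq I) (P : pred I) (F : I -> trop R) x :
  (forall i, P i -> F i <= x) -> \sum_(i <- r | P i) F i <= x.
Proof.
move=> Fx; elim/big_ind: _ => // y z yx zx.
by rewrite tropD ge_max yx.
Qed.

Lemma trop_sum_lt (I : Type) (r : seq I) (P : pred I) (F : I -> trop R) x :
  x != 0 -> (forall i, P i -> F i < x) -> \sum_(i <- r | P i) F i < x.
Proof.
rewrite -trop_gt0 => x0 Fx; elim/big_ind: _ => // y z yx zx.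
by rewrite tropD gt_max yx.
Qed.

Lemma trop_sum_att (I : finType) (F : I -> trop R) (i0 : I) :
  exists i, \sum_i F i = F i.
Proof.
have [i [_ ub]] : exists i, true /\ forall j, F j <= F i.
  case: (arg_maxP (P := xpredT) F (i0 := i0)) => // i _ ub.
  by exists i; split=> // j; apply: ub.
by exists i; apply: le_anti; rewrite trop_sum_ub // andbT trop_sum_le.
Qed.

Lemma trop_sum_neq0_att (I : finType) (F : I -> trop R) :
  \sum_i F i != 0 -> exists i, \sum_i F i = F i.
Proof.
case: (pickP I) => [i0 _ _|I0]; first exact: trop_sum_att i0.
by rewrite big1 ?eqxx // => i; have := I0 i.
Qed.

Section Entries.
Variables m n p : nat.

Lemma trop_mx_ub (A : 'M[trop R]_(m, n)) (B : 'M_(n, p)) i j k :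
  A i j * B j k <= (A *m B) i k.
Proof. by rewrite mxE (trop_sum_ub (fun j => A i j * B j k)). Qed.

End Entries.

Lemma trop_mx_att m n p (A : 'M[trop R]_(m, n.+1)) (B : 'M_(n.+1, p)) i k :
  exists j, (A *m B) i k = A i j * B j k.
Proof. by rewrite mxE; apply: trop_sum_att ord0. Qed.

Lemma trop_mx_pow_ub n (A : 'M[trop R]_n) a b i j k :
  (A ^+ a) i j * (A ^+ b) j k <= (A ^+ (a + b)) i k.
Proof. by rewrite exprD; apply: trop_mx_ub. Qed.

Lemma trop_mx_loop_ub n (A : 'M[trop R]_n) a b i :
  ((A ^+ a) i i) ^+ b <= (A ^+ (a * b)) i i.
Proof.
elim: b => [|b IH]; first by rewrite muln0 !expr0 mxE eqxx.
rewrite exprS mulnS; apply: le_trans (trop_mx_pow_ub _ _ _ _ _ _).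
exact: trop_leM.
Qed.

End TropTheory.

(** * Walks *)

Section Walks.
Local Open Scope ring_scope.
Variables (R : realDomainType) (n : nat).
Local Notation N := n.+1.
Implicit Types (A : 'M[trop R]_N) (Ms : nat -> 'M[trop R]_N).

Lemma walk_le Ms (x : nat -> 'I_N) a b : (a <= b)%N ->
  \prod_(a <= t < b) Ms t (x t) (x t.+1)
    <= (\prod_(a <= t < b) Ms t) (x a) (x b).
Proof.
move=> /subnKC <-; elim: (b - a)%N => [|d IH].
  by rewrite addn0 !big_geq // mxE eqxx.
rewrite addnS !big_nat_recr ?leq_addr //=.
by apply: le_trans (trop_mx_ub _ _ _ (x (a + d)%N) _); apply: trop_leM.
Qed.

Lemma walk_exists Ms a b i j : (a <= b)%N ->
  (\prod_(a <= t < b) Ms t) i j != 0 ->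
  exists x : nat -> 'I_N, [/\ x a = i, x b = j &
    (\prod_(a <= t < b) Ms t) i j = \prod_(a <= t < b) Ms t (x t) (x t.+1)].
Proof.
move=> /subnKC <-; elim: (b - a)%N j => [|d IH] j.
  rewrite addn0 !big_geq // mxE.
  have [<- _|_ /eqP//] := eqVneq i j.
  by exists (fun=> i); rewrite big_geq.
rewrite addnS !big_nat_recr ?leq_addr //=.
have [l ->] := trop_mx_att (\prod_(a <= t < a + d) Ms t) (Ms (a + d)%N) i j.
rewrite trop_mul_eq0 negb_or => /andP[/IH[x [xa xd ->]] _].
exists (fun t => if (t <= a + d)%N then x t else j).
rewrite leq_addr ltnn xa; split=> //.
rewrite big_nat_recr ?leq_addr //= leqnn ltnn xd.
by congr (_ * _); apply: eq_big_nat => t /andP[_ lt]; rewrite lt ltnW.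
Qed.

Lemma walk_pow_le A (x : nat -> 'I_N) a b : (a <= b)%N ->
  \prod_(a <= t < b) A (x t) (x t.+1) <= (A ^+ (b - a)) (x a) (x b).
Proof. by move=> ab; rewrite -prodr_const_nat; apply: walk_le. Qed.

(** A walk with as many steps as there are nodes visits some node twice. *)
Lemma pow_cycle A i j : exists (a b : nat) (l : 'I_N) (k : 'I_N),
  (a + l.+1 + b = N)%N /\
  (A ^+ N) i j <= (A ^+ a) i k * (A ^+ l.+1) k k * (A ^+ b) k j.
Proof.
have [z|nz] := eqVneq ((A ^+ N) i j) 0.
  exists 0, 0, ord_max, i; split; first by rewrite addn0.
  by rewrite z; apply: trop_ge0.
have eqX : \prod_(0 <= t < N) A = A ^+ N by rewrite prodr_const_nat subn0.
rewrite -eqX in nz *; have [x [x0 xN ->]] := walk_exists (leq0n N) nz.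
have [p [q [pq qN xpq]]] : exists p q, [/\ (p < q)%N, (q <= N)%N & x p = x q].
  have : ~~ injectiveb (fun p : 'I_N.+1 => x p).
    apply/negP => /injectiveP/leq_card.
    by rewrite !card_ord ltnn.
  case/injectivePn=> p [q pq xpq].
  case: (ltngtP p q) => [lt|lt|eq].
  - by exists p, q; split=> //; rewrite -ltnS.
  - by exists q, p; split=> //; rewrite -ltnS.
  - by case/eqP: pq; apply: val_inj.
have lN : ((q - p).-1 < N)%N by lia.
exists p, (N - q)%N, (Ordinal lN), (x p); split=> /=; first by lia.
rewrite (prednK (n := q - p)) ?subn_gt0 // -x0 -xN.
rewrite (big_cat_nat (n := p)) //=; last by lia.
rewrite (big_cat_nat (n := q) (m := p)) //=; last by lia.
rewrite mulrA; apply: trop_leM; last by rewrite xpq; apply: walk_pow_le.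
apply: trop_leM; last by rewrite {2}xpq; apply/walk_pow_le/ltnW.
by rewrite -[X in A ^+ X]subn0; apply: walk_pow_le.
Qed.

End Walks.

(** * Long walks concentrate on one loop *)

Section LongWalks.
Local Open Scope ring_scope.
Variables (R : realDomainType) (n : nat).
Local Notation N := n.+1.
Implicit Types A X : 'M[trop R]_N.

(** Each of K blocks of N steps contains a cycle. As the length which will occur
    often is not known in advance, the cycles are counted by length, and for
    every length those found so far are gathered at the best of them. *)
Lemma many_cycles A K i j : exists c : 'I_N -> nat,
  (\sum_l c l = K)%N /\
  forall l : 'I_N, exists a b (k : 'I_N), (a + l.+1 * c l + b = N * K)%N /\
    (A ^+ (N * K)) i j <= (A ^+ a) i k * ((A ^+ l.+1) k k) ^+ c l * (A ^+ b) k j.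
Proof.
elim: K i => [|K IH] i.
  exists (fun=> 0%N); split=> [|l]; first by rewrite big1.
  exists 0%N, 0%N, i; split; first by rewrite !muln0.
  by rewrite muln0 !expr0 mulr1 [(1%R : 'M_N) i i]mxE eqxx mul1r.
rewrite mulnS exprD.
have [k0 ->] := trop_mx_att (A ^+ N) (A ^+ (N * K)) i j.
have [a1 [b1 [l1 [k1 [len1 le1]]]]] := pow_cycle A i k0.
have [c [sumc cP]] := IH k0.
exists (fun l => c l + (l == l1))%N; split.
  rewrite big_split /= sumc addnC (bigD1 l1) //= eqxx big1 => [|l /negPf-> //].
  by rewrite addn0.
move=> l; have [a [b [k [len le]]]] := cP l; have [eq_l|_] := eqVneq l l1; last first.
  exists (N + a)%N, b, k; rewrite addn0; split; first by lia.
  apply: le_trans (trop_leM (lexx _) le) _; rewrite !mulrA.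
  by apply: trop_leM => //; apply: trop_leM => //; apply: trop_mx_pow_ub.
rewrite -{}eq_l in len1 le1; rewrite addn1.
set d1 := (A ^+ l.+1) k1 k1 in le1 *; set d := (A ^+ l.+1) k k in le *.
have ub : (A ^+ N) i k0 * (A ^+ (N * K)) k0 j <=
    (A ^+ a1) i k1 * (A ^+ b1) k1 k0 * (A ^+ a) k0 k *
    (d1 * d ^+ c l) * (A ^+ b) k j.
  apply: le_trans (trop_leM le1 le) _.
  have -> // : forall x y z t u v : trop R,
    x * y * z * (t * u * v) = x * z * t * (y * u) * v by move=> *; ring.
have [led|led] := leP d1 d.
  exists (a1 + b1 + a)%N, b, k; split; first by lia.
  apply: le_trans ub _; rewrite (exprS d).
  do 2?[apply: trop_leM => //]; last exact: trop_leM.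
  apply: le_trans (trop_mx_pow_ub _ _ _ _ k0 _); apply: trop_leM => //.
  exact: trop_mx_pow_ub.
exists a1, (b1 + a + b)%N, k1; split; first by lia.
apply: le_trans ub _; rewrite (exprS d1) -!mulrA.
apply: trop_leM => //; rewrite [X in X <= _](_ : _ =
  d1 * d ^+ c l * ((A ^+ b1) k1 k0 * (A ^+ a) k0 k * (A ^+ b) k j)); last by ring.
rewrite [leRHS]mulrA; apply: trop_leM.
  by apply: trop_leM => //; apply/trop_leX/ltW.
apply: le_trans (trop_mx_pow_ub _ _ _ _ k _); apply: trop_leM => //.
exact: trop_mx_pow_ub.
Qed.


Local Notation L := N`!.

(** By the pigeonhole principle some cycle length occurs 2L times. It divides
    L, so the copies of the best cycle of this length contain two closed walks
    of length L. *)
Lemma two_loops A i j : exists a b (k : 'I_N),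
  (a + L + L + b = N * (N * (2 * L)))%N /\
  (A ^+ (N * (N * (2 * L)))) i j <=
    (A ^+ a) i k * ((A ^+ L) k k * (A ^+ L) k k) * (A ^+ b) k j.
Proof.
have [c [sumc cP]] := many_cycles A (N * (2 * L)) i j.
have [l lel] : exists l, (2 * L <= c l)%N.
  apply/existsP; rewrite -[X in is_true X]negbK negb_exists.
  apply/negP => /forallP lt.
  suff : (\sum_l c l <= \sum_(l < N) (2 * L).-1)%N.
    by rewrite sumc sum_nat_const card_ord leq_pmul2l //; have := fact_gt0 N; lia.
  by apply: leq_sum => l _; have := lt l; have := fact_gt0 N; lia.
have [a [b [k [len le]]]] := cP l.
have dvL : (l.+1 %| L)%N by rewrite dvdn_fact // ltn_ord.
pose r := (L %/ l.+1)%N; have rL : (l.+1 * r = L)%N by rewrite mulnC divnK.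
have rc : (r + r <= c l)%N.
  by apply: leq_trans lel; rewrite mul2n -addnn leq_add // leq_div.
exists (a + l.+1 * (c l - (r + r)))%N, b, k; split.
  by rewrite -len -rL; nia.
apply: le_trans le _; rewrite -{1}(subnK rc) exprD exprD.
apply: trop_leM => //; rewrite mulrA; apply: trop_leM.
  apply: le_trans (trop_mx_pow_ub _ _ _ _ k _); apply: trop_leM => //.
  exact: trop_mx_loop_ub.
by apply: trop_leM; rewrite -rL; apply: trop_mx_loop_ub.
Qed.

(** The second of the two loops gives room to turn the first one until its base
    point is met at a time which is a multiple of L. *)
Lemma pow_loop A i j t : (2 * N * N <= t.+1)%N ->
  let X := A ^+ L in exists a b (k : 'I_N), (a + b = t)%N /\
    (X ^+ t.+1) i j <= (X ^+ a) i k * X k k * (X ^+ b) k j.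
Proof.
move=> le_t X; have L0 := fact_gt0 N.
pose M := (N * (N * (2 * L)))%N; have leM : (M <= L * t.+1)%N.
  by apply: leq_trans (leq_mul (leqnn L) le_t); rewrite /M; nia.
have [a [b [k [len le]]]] : exists a b (k : 'I_N), (a + L + L + b = L * t.+1)%N /\
    (X ^+ t.+1) i j <= (A ^+ a) i k * (X k k * X k k) * (A ^+ b) k j.
  rewrite -exprM -(subnKC leM) exprD.
  have [k0 ->] := trop_mx_att (A ^+ M) (A ^+ (L * t.+1 - M)) i j.
  have [a [b [k [len le]]]] := two_loops A i k0.
  exists a, (b + (L * t.+1 - M))%N, k; split; first by rewrite addnA len.
  apply: le_trans (trop_leM le (lexx _)) _; rewrite -!mulrA.
  by do 3![apply: trop_leM => //]; apply: trop_mx_pow_ub.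
(* The walk is at k from step a on, and at k' at step L * q. *)
pose q := (a %/ L).+1; pose e := (L * q - a)%N.
have aE := divn_eq a L; have altL := ltn_pmod a L0.
have ae : (a + e = L * q)%N by rewrite /e /q; nia.
have eL : (e <= L)%N by rewrite /e /q; nia.
have qt : (q <= t)%N by rewrite -ltnS -(ltn_pmul2l L0) -ae; nia.
have [k' Xk] : exists k', X k k = (A ^+ e) k k' * (A ^+ (L - e)) k' k.
  have [k' eqk'] := trop_mx_att (A ^+ e) (A ^+ (L - e)) k k.
  by exists k'; rewrite -eqk' mulmxE -exprD subnKC.
exists q, (t - q)%N, k'; split; first exact: subnKC.
apply: le_trans le _; rewrite Xk.
rewrite [leLHS](_ : _ = (A ^+ a) i k * (A ^+ e) k k' *
  ((A ^+ (L - e)) k' k * (A ^+ e) k k') * ((A ^+ (L - e)) k' k * (A ^+ b) k j));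
  last by ring.
rewrite -!exprM; apply: trop_leM; first apply: trop_leM.
- by rewrite -ae; apply: trop_mx_pow_ub.
- by rewrite /X -{2}(subnK eL); apply: trop_mx_pow_ub.
- have -> : (L * (t - q) = L - e + b)%N by rewrite mulnBr -ae; nia.
  exact: trop_mx_pow_ub.
Qed.

(** Loops inserted into the parts before and after k can all be moved to the
    heaviest of the nodes at which they are based, since k itself stays on the
    walk. *)
Lemma pow_concentrates A i j t :
  let X := A ^+ L in exists a b m (k : 'I_N),
    [/\ (a <= 2 * N * N)%N, (b <= 2 * N * N)%N, (a + m + b = t)%N &
    (X ^+ t) i j <= (X ^+ a) i k * X k k ^+ m * (X ^+ b) k j].
Proof.
move=> X.
suff H s : forall a b m k, (a + b <= s)%N -> exists a' b' m' (k' : 'I_N),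
    [/\ (a' <= 2 * N * N)%N, (b' <= 2 * N * N)%N, (a' + m' + b' = a + m + b)%N &
    (X ^+ a) i k * X k k ^+ m * (X ^+ b) k j <=
    (X ^+ a') i k' * X k' k' ^+ m' * (X ^+ b') k' j].
  have [a [b [m [k [? ? len le]]]]] := H (0 + t)%N 0%N t 0%N i (leqnn _).
  exists a, b, m, k; split=> //; apply: le_trans le.
  by rewrite !expr0 mulr1 [(1%R : 'M_N) i i]mxE eqxx mul1r.
elim: s => [|s IH] a b m k abs.
  by exists a, b, m, k; split=> //; lia.
have [lea|lta] := leqP a (2 * N * N)%N; last first.
  case: a => // a in abs lta *.
  have [a1 [b1 [k1 [len le]]]] := pow_loop A i k (ltnW lta : (_ <= a.+1)%N).
  have [led|led] := leP (X k k) (X k1 k1).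
    have abs' : (a1 + (b1 + b) <= s)%N by lia.
    have [a' [b' [m' [k' [? ? len' le']]]]] := IH a1 (b1 + b)%N m.+1 k1 abs'.
    exists a', b', m', k'; split=> //; first by lia.
    apply: le_trans le'; apply: le_trans (trop_leM (trop_leM le (lexx _)) (lexx _)) _.
    rewrite [leLHS](_ : _ = (X ^+ a1) i k1 * (X k1 k1 * X k k ^+ m) *
      ((X ^+ b1) k1 k * (X ^+ b) k j)); last by rewrite /X; ring.
    rewrite (exprS (X k1 k1)); apply: trop_leM; last exact: trop_mx_pow_ub.
    by apply: trop_leM => //; apply: trop_leM => //; apply: trop_leX.
  have abs' : (a1 + b1 + b <= s)%N by lia.
  have [a' [b' [m' [k' [? ? len' le']]]]] := IH (a1 + b1)%N b m.+1 k abs'.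
  exists a', b', m', k'; split=> //; first by lia.
  apply: le_trans le'; apply: le_trans (trop_leM (trop_leM le (lexx _)) (lexx _)) _.
  rewrite [leLHS](_ : _ = (X ^+ a1) i k1 * (X ^+ b1) k1 k *
      (X k1 k1 * X k k ^+ m) * (X ^+ b) k j); last by rewrite /X; ring.
  rewrite (exprS (X k k)); apply: trop_leM => //; apply: trop_leM.
    exact: trop_mx_pow_ub.
  by apply: trop_leM => //; apply: ltW.
have [leb|ltb] := leqP b (2 * N * N)%N; first by exists a, b, m, k.
case: b => // b in abs ltb *.
have [a1 [b1 [k1 [len le]]]] := pow_loop A k j (ltnW ltb : (_ <= b.+1)%N).
have [led|led] := leP (X k k) (X k1 k1).
  have abs' : (a + a1 + b1 <= s)%N by lia.
  have [a' [b' [m' [k' [? ? len' le']]]]] := IH (a + a1)%N b1 m.+1 k1 abs'.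
  exists a', b', m', k'; split=> //; first by lia.
  apply: le_trans le'; apply: le_trans (trop_leM (lexx _) le) _.
  rewrite [leLHS](_ : _ = (X ^+ a) i k * (X ^+ a1) k k1 *
    (X k1 k1 * X k k ^+ m) * (X ^+ b1) k1 j); last by rewrite /X; ring.
  rewrite (exprS (X k1 k1)); apply: trop_leM => //.
  apply: trop_leM; first exact: trop_mx_pow_ub.
  by apply: trop_leM => //; apply: trop_leX.
have abs' : (a + (a1 + b1) <= s)%N by lia.
have [a' [b' [m' [k' [? ? len' le']]]]] := IH a (a1 + b1)%N m.+1 k abs'.
exists a', b', m', k'; split=> //; first by lia.
apply: le_trans le'; apply: le_trans (trop_leM (lexx _) le) _.
rewrite [leLHS](_ : _ = (X ^+ a) i k * (X k1 k1 * X k k ^+ m) *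
  ((X ^+ a1) k k1 * (X ^+ b1) k1 j)); last by rewrite /X; ring.
rewrite (exprS (X k k)); apply: trop_leM; last exact: trop_mx_pow_ub.
by apply: trop_leM => //; apply: trop_leM => //; apply: ltW.
Qed.

End LongWalks.

(** * Dominant permutations *)

Section Dominant.
Local Open Scope ring_scope.
Variables (R : realDomainType) (n : nat).
Local Notation N := n.+1.
Local Notation L := N`!.
Implicit Types (A B X : 'M[trop R]_N) (s : 'S_N).

Lemma perm_expg_fact s : (s ^+ L = 1)%g.
Proof. by rewrite -(expg_cardG (in_setT s)) cardsT card_Sn. Qed.

Definition perm_weight A s : trop R := \prod_i A i (s i).

Lemma perm_weight1 A : perm_weight A 1%g = \prod_i A i i.
Proof. by apply: eq_bigr => i _; rewrite perm1. Qed.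

(** Tropical nonsingularity of [A], with the permanent attained only at [s]. *)
Definition dominant A s : Prop :=
  perm_weight A s != 0 /\ forall s', s' != s -> perm_weight A s' < perm_weight A s.

Lemma dominant_uniq A s s' : dominant A s -> dominant A s' -> s = s'.
Proof.
move=> [_ d] [_ d']; apply/eqP; apply: contraT => ss'.
by move: (lt_trans (d' _ ss') (d _ (contra_neq (@esym _ _ _) ss'))); rewrite ltxx.
Qed.

Lemma perm_weightM A B s1 s2 :
  perm_weight A s1 * perm_weight B s2 <= perm_weight (A * B) (s1 * s2)%g.
Proof.
rewrite /perm_weight [X in _ * X](reindex_inj (perm_inj (s := s1))) /=.
rewrite -big_split; apply: trop_le_prod => i _; rewrite permM.
exact: trop_mx_ub.
Qed.

(** The optimal walks from i to [s i] pass through distinct nodes between the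
    two factors: if two of them met there, exchanging their ends would give a
    second optimal permutation. *)
Lemma dominant_split A B s : dominant (A * B) s ->
  exists s1 s2, [/\ s = (s1 * s2)%g &
    perm_weight (A * B) s = perm_weight A s1 * perm_weight B s2].
Proof.
move=> [nz dom].
have [f fP] : exists f : {ffun 'I_N -> 'I_N},
    forall i, (A * B) i (s i) = A i (f i) * B (f i) (s i).
  have [f fP] := fin_all_exists (fun i => trop_mx_att A B i (s i)).
  by exists (finfun f) => i; rewrite ffunE.
have f_inj : injective f.
  move=> i j fij; apply/eqP; apply: contraT => ij.
  pose s' := (tperm i j * s)%g.
  have s'P : s' != s.
    apply/eqP => /(congr1 (fun u : 'S_N => u i)); rewrite permM tpermL.
    by move/perm_inj => ji; rewrite ji eqxx in ij.
  have := dom _ s'P; rewrite ltNge => /negP[].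
  rewrite /perm_weight (eq_bigr _ (fun i _ => fP i)) big_split /=.
  rewrite [X in _ * X](reindex_inj (perm_inj (s := tperm i j))) /=.
  rewrite -big_split /=; apply: trop_le_prod => k _; rewrite permM.
  have -> : f (tperm i j k) = f k.
    by case: tpermP => [->|->|].
  exact: trop_mx_ub.
pose s1 := perm f_inj; exists s1, (s1^-1 * s)%g; split; first by rewrite mulKVg.
rewrite /perm_weight (eq_bigr _ (fun i _ => fP i)) big_split /=.
congr (_ * _); first by apply: eq_bigr => i _; rewrite permE.
rewrite [RHS](reindex_inj (perm_inj (s := s1))) /=.
by apply: eq_bigr => i _; rewrite permM permK permE.
Qed.

Lemma dominantM A B s : dominant (A * B) s -> exists s1 s2,
  [/\ s = (s1 * s2)%g, dominant A s1, dominant B s2 &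
    perm_weight (A * B) s = perm_weight A s1 * perm_weight B s2].
Proof.
move=> D; have [s1 [s2 [sE wE]]] := dominant_split D.
case: D => nz dom; move: (nz); rewrite wE trop_mul_eq0 negb_or => /andP[nz1 nz2].
exists s1, s2; split=> //; split=> // s' neq; rewrite ltNge; apply/negP => le.
- have := dom (s' * s2)%g; rewrite sE (can_eq (mulgK s2)) -sE => /(_ neq).
  apply/negP; rewrite -leNgt wE; apply: le_trans (perm_weightM _ _ _ _).
  exact: trop_leM.
- have := dom (s1 * s')%g; rewrite sE (can_eq (mulKg s1)) -sE => /(_ neq).
  apply/negP; rewrite -leNgt wE; apply: le_trans (perm_weightM _ _ _ _).
  exact: trop_leM.
Qed.

Lemma dominantX A k s : dominant (A ^+ k.+1) s ->
  exists2 s1, dominant A s1 & s = (s1 ^+ k.+1)%g.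
Proof.
elim: k s => [|k IH] s D; first by exists s; rewrite ?expg1.
rewrite exprS in D; have [s1 [s2 [-> D1 /IH[s3 D3 ->] _]]] := dominantM D.
by exists s1 => //; rewrite (dominant_uniq D3 D1) -expgS.
Qed.

End Dominant.

(** * Powers of singular matrices lose factor rank *)

Section RankDrop.
Local Open Scope ring_scope.
Variables (R : realDomainType) (n : nat).
Local Notation N := n.+1.
Local Notation L := N`!.
Implicit Types (A X : 'M[trop R]_N).

(** An excursion to another node is as good as q loops at k. *)
Definition avoidable X q k : bool :=
  X k k ^+ q <= \sum_(k1 | k1 != k) X k k1 * (X ^+ q.-1) k1 k.

(** This says that the factor rank, or Barvinok rank, of A is at most m. *)
Definition factors_through m (A : 'M[trop R]_N) : Prop :=
  exists (C : 'M_(N, m)) (D : 'M_(m, N)), A = C *m D.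

(** All walks stay on one node for a long time around the step M; those staying
    on the avoidable node k0 are diverted so as to be elsewhere at this step.
    Thus the intermediate node k0 may be left out of
    X ^+ T = X ^+ M * X ^+ (T - M). *)
Lemma avoidable_factors A q k0 : (0 < q)%N -> avoidable (A ^+ L) q k0 ->
  factors_through n (A ^+ (L * (4 * N * N + q))).
Proof.
move=> q0 av; set X := A ^+ L in av *.
pose t0 := (2 * N * N)%N; pose T := (t0 + t0 + q)%N; pose M := t0.+1.
have -> : A ^+ (L * (4 * N * N + q)) = X ^+ T.
  by rewrite -exprM /T /t0; congr (A ^+ (_ * _)); lia.
have MT : (M <= T)%N by rewrite /M /T; lia.
have loop w k : X k k ^+ w <= (X ^+ w) k k.
  by have := trop_mx_loop_ub X 1 w k; rewrite mul1n expr1.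
exists (col' k0 (X ^+ M)), (row' k0 (X ^+ (T - M))).
set CD := _ *m _.
have colE B i l : col' k0 B i l = B i (lift k0 l) :> trop R by rewrite mxE.
have rowE B l j : row' k0 B l j = B (lift k0 l) j :> trop R by rewrite mxE.
have ub i j k : k != k0 -> (X ^+ M) i k * (X ^+ (T - M)) k j <= CD i j.
  rewrite eq_sym => /unlift_some[l -> _].
  have := trop_mx_ub (col' k0 (X ^+ M)) (row' k0 (X ^+ (T - M))) i l j.
  by rewrite colE rowE.
apply/matrixP => i j; apply: le_anti; apply/andP; split; last first.
  rewrite mxE; apply: trop_sum_le => l _.
  rewrite colE rowE -{2}(subnKC MT).
  exact: trop_mx_pow_ub.
have [a [b [m [k [lea leb len le]]]]] := pow_concentrates A i j T.
rewrite -/X in le; apply: le_trans le _.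
(* After u loops the walk is at k one step before M, where a diverted walk
   leaves k. *)
pose u := (t0 - a)%N.
have uE : (a + u + 1 = M)%N by rewrite /M /u /t0; lia.
have [eqk|kk0] := eqVneq k k0; last first.
  apply: le_trans (ub i j k kk0); have -> : m = (u.+1 + (m - u.+1))%N.
    by rewrite subnKC //; rewrite /T /t0 in len; rewrite /u /t0; lia.
  rewrite exprD mulrA -mulrA; apply: trop_leM.
    rewrite -uE -addnA addn1; apply: le_trans (trop_mx_pow_ub _ _ _ _ k _).
    exact: trop_leM.
  have -> : (T - M = (m - u.+1) + b)%N.
    by rewrite /M /T /t0 in len *; rewrite /u /t0; lia.
  apply: le_trans (trop_mx_pow_ub _ _ _ _ k _).
  exact: trop_leM.
rewrite {}eqk; pose v := (m - u - q)%N.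
have -> : m = (u + q + v)%N.
  by rewrite /v; rewrite /T /t0 in len; rewrite /u /t0; lia.
rewrite !exprD.
have le : X k0 k0 ^+ u * X k0 k0 ^+ q * X k0 k0 ^+ v <= X k0 k0 ^+ u *
    (\sum_(k1 | k1 != k0) X k0 k1 * (X ^+ q.-1) k1 k0) * X k0 k0 ^+ v.
  by apply: trop_leM => //; apply: trop_leM.
apply: le_trans (trop_leM (trop_leM (lexx _) le) (lexx _)) _.
rewrite mulr_sumr mulr_suml mulr_sumr mulr_suml; apply: trop_sum_le => k1 k1P.
apply: le_trans (ub i j k1 k1P).
rewrite [leLHS](_ : _ = (X ^+ a) i k0 * X k0 k0 ^+ u * X k0 k1 *
  ((X ^+ q.-1) k1 k0 * (X k0 k0 ^+ v * (X ^+ b) k0 j))); last by ring.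
apply: trop_leM.
  rewrite -uE; apply: le_trans (trop_mx_pow_ub _ _ _ _ k0 _).
  rewrite expr1; apply: trop_leM => //.
  by apply: le_trans (trop_mx_pow_ub _ _ _ _ k0 _); apply: trop_leM.
have -> : (T - M = q.-1 + (v + b))%N.
  by rewrite /v /M /T /t0 in len *; rewrite /u /t0; lia.
apply: le_trans (trop_mx_pow_ub _ _ _ _ k0 _); apply: trop_leM => //.
by apply: le_trans (trop_mx_pow_ub _ _ _ _ k0 _); apply: trop_leM.
Qed.

(** Following s from k for L steps leads back to k, as L is the order of the
    symmetric group; every such walk is lighter than the loops at k unless s
    fixes k, and the product of their weights over all k is the L-th power of
    the weight of s. *)
Lemma unavoidable_dominant X :
  (forall k, ~~ avoidable X L k) -> dominant X 1%g.
Proof.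
move=> unav; have L0 := fact_gt0 N.
have lt k k1 : k1 != k -> X k k1 * (X ^+ L.-1) k1 k < X k k ^+ L.
  move=> ne; have := unav k; rewrite -ltNge; apply: le_lt_trans.
  exact: (trop_sum_ub (fun k1 => X k k1 * (X ^+ L.-1) k1 k)).
have nz k : X k k != 0.
  have := unav k; rewrite -ltNge => /(le_lt_trans (trop_ge0 _)).
  by rewrite trop_gt0; apply: contra_neq => ->; rewrite expr0n gtn_eqF.
have w1 := perm_weight1 X.
split=> [|s s1]; first by rewrite w1 trop_prod_neq0.
rewrite ltNge; apply/negP => le.
have sL := perm_expg_fact s.
pose W k := \prod_(0 <= t < L) X ((s ^+ t)%g k) ((s ^+ t.+1)%g k).
have W_lt k : s k != k -> W k < X k k ^+ L.
  move=> sk; apply: le_lt_trans (lt _ _ sk).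
  rewrite /W -(prednK L0) big_ltn // expg0 perm1 expg1 (prednK L0).
  apply: trop_leM => //.
  have := walk_pow_le X (fun t => (s ^+ t)%g k) (L0 : (1 <= L)%N).
  by rewrite subn1 sL perm1.
have W_le k : W k <= X k k ^+ L.
  have [/W_lt/ltW //|/negbNE/eqP sk] := boolP (s k != k).
  rewrite /W (eq_bigr (fun=> X k k)) => [|t _].
    by rewrite prodr_const_nat subn0.
  have fix_ m : (s ^+ m)%g k = k.
    by elim: m => [|m IH]; rewrite ?perm1 // expgS permM sk.
  by rewrite !fix_.
have [k sk] : exists k, s k != k.
  apply/existsP; rewrite -[X in is_true X]negbK negb_exists.
  apply: contra s1 => /forallP id_s; apply/eqP/permP => k.
  by rewrite perm1; apply/eqP; have := id_s k; rewrite negbK.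
have : \prod_k W k < \prod_k X k k ^+ L.
  apply: (trop_lt_prod W_le _ (W_lt k sk)) => i.
  exact: trop_exp_neq0.
rewrite ltNge => /negP; apply.
rewrite prodrXl -w1; apply: le_trans (trop_leX L le) _.
rewrite /W exchange_big /= -[in leLHS](subn0 L) -prodr_const_nat.
apply: trop_le_prod => t _; rewrite /perm_weight (reindex_inj (perm_inj (s := (s ^+ t)%g))).
by apply: trop_le_prod => i _; rewrite expgSr permM.
Qed.

Definition drop_exponent : nat := (L * (4 * N * N + L))%N.

Lemma singular_pow_factors A : (forall s, ~ dominant A s) ->
  factors_through n (A ^+ drop_exponent).
Proof.
move=> sing; have [/existsP[k]|] := boolP [exists k, avoidable (A ^+ L) L k].
  by apply: avoidable_factors; apply: fact_gt0.
rewrite negb_exists => /forallP/unavoidable_dominant.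
rewrite -(prednK (fact_gt0 N)) => /dominantX[s /sing//].
Qed.

End RankDrop.

(** * Counting the jumps of a walk *)

Section Jumps.
Local Open Scope ring_scope.
Variables (R : realDomainType) (n : nat).
Local Notation N := n.+1.
Implicit Types (A B M : 'M[trop R]_N) (Ms : nat -> 'M[trop R]_N).
Implicit Types (p q x y : {poly 'M[trop R]_N}).

Definition diag_part M : 'M[trop R]_N := diag_mx (\row_i M i i).
Definition off_part M : 'M[trop R]_N := \matrix_(i, j) (if i == j then 0 else M i j).

(** The indeterminate counts the jumps, i.e. the steps which change the node:
    the coefficient of index s of a product of such polynomials is the optimal
    weight of the walks with exactly s jumps. *)
Definition jump_poly M : {poly 'M[trop R]_N} :=
  (diag_part M)%:P + (off_part M)%:P * 'X.

Lemma jump_poly_coef0 M : (jump_poly M)`_0 = diag_part M.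
Proof. by rewrite coefD coefC coefMX addr0. Qed.

Lemma jump_poly_coef1 M : (jump_poly M)`_1 = off_part M.
Proof. by rewrite coefD coefC coefMX coefC add0r. Qed.

Lemma diag_part_le M i j : diag_part M i j <= M i j.
Proof. by rewrite !mxE; case: eqVneq => [->|_]. Qed.

Lemma off_part_le M i j : off_part M i j <= M i j.
Proof. by rewrite mxE; case: ifP. Qed.

Lemma trop_mulmx_le A A' B B' i j :
  (forall i j, A i j <= A' i j) -> (forall i j, B i j <= B' i j) ->
  (A * B) i j <= (A' * B') i j.
Proof.
move=> leA leB; rewrite mxE; apply: trop_sum_le => k _.
by apply: le_trans (trop_mx_ub _ _ _ k _); apply: trop_leM.
Qed.

Lemma jump_coef_le Ms a b s i j : (a <= b)%N ->
  (\prod_(a <= t < b) jump_poly (Ms t))`_s i j <= (\prod_(a <= t < b) Ms t) i j.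
Proof.
move=> /subnKC <-; elim: (b - a)%N s i j => [|d IH] s i j.
  rewrite addn0 !big_geq // coef1; case: eqP => //= _.
  by rewrite mxE.
rewrite addnS !big_nat_recr ?leq_addr //= mulrDr coefD mulrA coefMC coefMX coefMC.
rewrite mxE tropD ge_max; apply/andP; split.
  by apply: trop_mulmx_le => // *; apply: diag_part_le.
case: eqP => [_|_]; first by rewrite mxE.
by apply: trop_mulmx_le => // *; apply: off_part_le.
Qed.

Lemma coefM_ub p q a b i k j : p`_a i k * q`_b k j <= (p * q)`_(a + b) i j.
Proof.
rewrite coefM summxE.
have la : (a < (a + b).+1)%N by rewrite ltnS leq_addr.
apply: le_trans (trop_sum_ub
  (fun l : 'I_(a + b).+1 => (p`_l * q`_(a + b - l)) i j) (i := Ordinal la) isT).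
by rewrite /= addKn; apply: trop_mx_ub.
Qed.

Lemma jump_prod_coef0 Ms a b :
  (\prod_(a <= t < b) jump_poly (Ms t))`_0 =
  diag_mx (\row_i \prod_(a <= t < b) Ms t i i).
Proof.
have [ba|/ltnW/subnKC <-] := leqP b a.
  rewrite big_geq // coef1; apply/matrixP => i j; rewrite !mxE big_geq //.
elim: (b - a)%N => [|d IH].
  rewrite addn0 big_geq // coef1; apply/matrixP => i j; rewrite !mxE big_geq //.
rewrite addnS big_nat_recr ?leq_addr //= coefM big_ord1 IH jump_poly_coef0.
rewrite -mulmxE mulmx_diag; congr diag_mx; apply/rowP => i.
by rewrite !mxE big_nat_recr ?leq_addr.
Qed.

(** Keep the walk on its first node k until the last visit to k, which does not
    make it lighter if closed walks are not heavier than constant ones, and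
    proceed in the same way from the next node, which avoids k. The jumps left
    lead to pairwise distinct nodes. *)
Lemma few_jumps Ms (x : nat -> 'I_N) m :
  (forall a b k, (a <= b <= m)%N ->
    (\prod_(a <= t < b) Ms t) k k <= \prod_(a <= t < b) Ms t k k) ->
  exists2 s, (s < N)%N & \prod_(0 <= t < m) Ms t (x t) (x t.+1) <=
    (\prod_(0 <= t < m) jump_poly (Ms t))`_s (x 0%N) (x m).
Proof.
move=> closed; pose V a := [set x t | t : 'I_m.+1 & (a <= t)%N].
suff H d a : (a <= m)%N -> (#|V a| <= d)%N ->
    exists2 s, (s < d)%N & \prod_(a <= t < m) Ms t (x t) (x t.+1) <=
    (\prod_(a <= t < m) jump_poly (Ms t))`_s (x a) (x m).
  by apply: H => //; rewrite -[leqRHS]card_ord max_card.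
elim: d a => [|d IH] a am leV.
  move: leV; rewrite leqn0 cards_eq0 => /eqP V0.
  have : x m \in V a by apply/imsetP; exists ord_max; rewrite ?inE.
  by rewrite V0 inE.
have ex : exists t, (a <= t <= m)%N && (x t == x a) by exists a; rewrite leqnn am /=.
have ub t : (a <= t <= m)%N && (x t == x a) -> (t <= m)%N by case/andP=> /andP[].
case: (ex_maxnP ex ub) => l /andP[/andP[al lm] /eqP xl] lmax.
have closed_al : \prod_(a <= t < l) Ms t (x t) (x t.+1) <=
    \prod_(a <= t < l) Ms t (x a) (x a).
  apply: le_trans (walk_le _ _ al) _; rewrite xl; apply: closed.
  by rewrite al.
case: (ltngtP l m) (lm) => // [ltlm _|eqlm _]; last first.
  exists 0%N => //; rewrite jump_prod_coef0 !mxE -eqlm xl eqxx.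
  exact: closed_al.
have subV : V l.+1 \subset V a :\ x a.
  apply/subsetP => k /imsetP[t]; rewrite inE => lt ->.
  rewrite !inE; apply/andP; split; last first.
    by apply/imsetP; exists t => //; rewrite inE; lia.
  apply/eqP => xta; have := lmax t; rewrite xta eqxx andbT.
  by have := ltn_ord t; lia.
have xaV : x a \in V a.
  have lta : (a < m.+1)%N by [].
  by apply/imsetP; exists (Ordinal lta); rewrite ?inE.
have cardV : (#|V l.+1| <= d)%N.
  by have := subset_leq_card subV; have := cardsD1 (x a) (V a); rewrite xaV; lia.
have [s sd le] := IH l.+1 ltlm cardV.
have neq : x a != x l.+1.
  apply/eqP => xal; have := lmax l.+1; rewrite -xal eqxx andbT.
  by lia.
exists s.+1 => //.
rewrite !(big_cat_nat (m := a) (n := l) (p := m)) //= !(big_ltn ltlm).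
rewrite -[s.+1]add0n; apply: le_trans (coefM_ub _ _ _ _ _ (x a) _).
apply: trop_leM.
  by rewrite jump_prod_coef0 !mxE eqxx.
rewrite -[s.+1]add1n; apply: le_trans (coefM_ub _ _ _ _ _ (x l.+1) _).
by apply: trop_leM => //; rewrite jump_poly_coef1 mxE (negPf neq) xl.
Qed.

End Jumps.

(** * Words *)

Section Words.
Local Open Scope ring_scope.
Implicit Types u v w : seq bool.

Definition word_eval (S : pzSemiRingType) (x y : S) w : S :=
  \prod_(c <- w) (if c then x else y).

Definition word_subst u v w : seq bool :=
  flatten [seq if c then u else v | c <- w].

Lemma word_eval_cat (S : pzSemiRingType) (x y : S) u v :
  word_eval x y (u ++ v) = word_eval x y u * word_eval x y v.
Proof. exact: big_cat. Qed.

Lemma word_eval_nseq (S : pzSemiRingType) (x y : S) k c :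
  word_eval x y (nseq k c) = (if c then x else y) ^+ k.
Proof.
rewrite /word_eval; elim: k => [|k IH]; first by rewrite big_nil.
by rewrite big_cons IH exprS.
Qed.

Lemma word_eval_subst (S : pzSemiRingType) (x y : S) u v w :
  word_eval x y (word_subst u v w) =
  word_eval (word_eval x y u) (word_eval x y v) w.
Proof.
rewrite {1 4}/word_eval /word_subst big_flatten big_map.
by apply: eq_bigr => -[].
Qed.

Lemma word_eval_diag (S : pzSemiRingType) (x : S) w :
  word_eval x x w = x ^+ size w.
Proof.
rewrite /word_eval; elim: w => [|c w IH]; first by rewrite big_nil.
by rewrite big_cons IH exprS; case: c.
Qed.

Lemma size_word_subst u v w : size u = size v ->
  size (word_subst u v w) = (size w * size u)%N.
Proof.
move=> uv; rewrite /word_subst size_flatten /shape -map_comp sumnE big_map.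
rewrite (eq_bigr (fun=> size u)) => [|[] _] //=.
by rewrite big_const_seq count_predT iter_addn_0 mulnC.
Qed.

(** Distinct words of equal length form a code. *)
Lemma word_subst_inj u v : size u = size v -> u != v ->
  injective (word_subst u v).
Proof.
move=> uv neq; have u0 : (0 < size u)%N.
  by case: u v uv neq => [|? ?] [|? ?].
have nil_cons c w : word_subst u v (c :: w) = [::] -> False.
  move/(congr1 size); rewrite size_word_subst //= mulSn.
  by lia.
elim=> [|c w IH] [|c' w'] // => [/esym/nil_cons//|/nil_cons//|/eqP].
rewrite /word_subst /= eqseq_cat; last by case: c c' => -[].
case/andP=> /eqP cc' /eqP/IH ->; congr (_ :: _).
by case: c c' cc' neq => -[] // ->; rewrite eqxx.
Qed.

(** For any x and y the two words of level r agree on walks with at most r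
    jumps. The outer pattern allows one more jump: it only exchanges the letters
    of the central pair, and both letters occur to the left and to the right of
    it. *)
Fixpoint swap_words r : seq bool * seq bool :=
  if r is r'.+1 then let: (u, v) := swap_words r' in
    (word_subst u v [:: true; false; true; false; true; false],
     word_subst u v [:: true; false; false; true; true; false])
  else ([:: true; false], [:: false; true]).

Lemma size_swap_words r : size (swap_words r).1 = size (swap_words r).2.
Proof.
elim: r => //= r; case: swap_words => u v /= uv.
by rewrite !size_word_subst.
Qed.

Lemma swap_words_neq r : (swap_words r).1 != (swap_words r).2.
Proof.
elim: r => //= r; have := size_swap_words r.
case: swap_words => u v /= uv neq.
by apply/eqP => /(word_subst_inj uv neq).
Qed.

End Words.

Section Swap.
Local Open Scope ring_scope.
Variables (R : realDomainType) (n : nat).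
Local Notation N := n.+1.
Implicit Types (p q x y z : {poly 'M[trop R]_N}) (d e : 'rV[trop R]_N).

Definition eq_upto k p q : Prop := forall s, (s <= k)%N -> p`_s = q`_s.

Lemma eq_uptoM k p p' q q' :
  eq_upto k p p' -> eq_upto k q q' -> eq_upto k (p * q) (p' * q').
Proof.
move=> pp qq s sk; rewrite !coefM; apply: eq_bigr => i _.
by rewrite pp ?qq // (leq_trans _ sk) ?leq_subr // -ltnS.
Qed.

Lemma coefM_ends p q k : (p * q)`_k.+1 =
  p`_0 * q`_k.+1 + \sum_(s < k) p`_s.+1 * q`_(k - s) + p`_k.+1 * q`_0.
Proof.
rewrite coefM big_ord_recr big_ord_recl /= subnn subn0.
by under eq_bigr do rewrite subSS.
Qed.

Lemma coef0_diagM p q d e : p`_0 = diag_mx d -> q`_0 = diag_mx e ->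
  (p * q)`_0 = diag_mx (\row_i (d 0 i * e 0 i)).
Proof. by move=> pd qe; rewrite coefM big_ord1 pd qe -mulmxE mulmx_diag. Qed.

Lemma swap_absorb (a b u v m z t : trop R) :
  z = a * v + m + u * b -> t = z \/ t = a * u + m + v * b ->
  a * a * t * (b * b) <= a * a * (a * a * z) + z * (b * b) * (b * b).
Proof.
move=> zE tP; have [le_ab|/ltW le_ba] := leP a b.
  apply: (@le_trans _ _ (z * (b * b) * (b * b))); last by rewrite tropD le_max lexx orbT.
  have le2 : a * a <= b * b by apply: trop_leM.
  case: tP => ->.
    by apply: trop_leM => //; rewrite mulrC; apply: trop_leM.
  rewrite zE [leLHS](_ : _ = (a * a * a) * u * (b * b) + (a * a) * m * (b * b) +
    (a * a) * (v * (b * b * b))); last by ring.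
  rewrite [leRHS](_ : _ = (b * b * b) * u * (b * b) + (b * b) * m * (b * b) +
    (b * a) * (v * (b * b * b))); last by ring.
  by rewrite !tropD; do !apply: le_max2; do !apply: trop_leM.
apply: (@le_trans _ _ (a * a * (a * a * z))); last by rewrite tropD le_max lexx.
have le2 : b * b <= a * a by apply: trop_leM.
case: tP => ->.
  by rewrite -mulrA; apply: trop_leM => //; rewrite mulrC; apply: trop_leM.
rewrite zE [leLHS](_ : _ = (a * a * a * u) * (b * b) + (a * a) * m * (b * b) +
  (a * a) * (v * (b * b * b))); last by ring.
rewrite [leRHS](_ : _ = (a * a * a * u) * (a * b) + (a * a) * m * (a * a) +
  (a * a) * (v * (a * a * a))); last by ring.
by rewrite !tropD; do !apply: le_max2; do !apply: trop_leM.
Qed.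

(** The coefficients of index k.+1 of x and y enter linearly, surrounded by
    powers of the common diagonal d: all the jumps are in one block. Such a term
    has the form d i ^+ a * _ * d j ^+ b with a + b = 5, and is dominated by a
    term with more factors d i or by one with more factors d j. So only the outermost
    occurrences of x and of y matter, and they are the same on both sides. *)
Lemma swap_eq_upto x y d k : x`_0 = diag_mx d -> eq_upto k x y ->
  eq_upto k.+1 (x * y * (x * y * (x * y))) (x * y * (y * x * (x * y))).
Proof.
move=> xd xy; have yx : eq_upto k y x by move=> s /xy.
have yd : y`_0 = diag_mx d by rewrite -xy.
set z := x * y; set w := y * x.
have zw : eq_upto k z w by apply: eq_uptoM.
move=> s; rewrite leq_eqVlt => /orP[/eqP ->{s}|]; last first.
  by rewrite ltnS; apply: eq_uptoM => //; apply: eq_uptoM.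
pose g := \row_i (d 0 i * d 0 i).
have zg : z`_0 = diag_mx g by apply: coef0_diagM.
have wg : w`_0 = diag_mx g by apply: coef0_diagM.
have low p q p' q' : eq_upto k p p' -> eq_upto k q q' ->
    \sum_(s < k) p`_s.+1 * q`_(k - s) = \sum_(s < k) p'`_s.+1 * q'`_(k - s).
  move=> pp qq; apply: eq_bigr => s _; have := ltn_ord s => lt.
  by rewrite pp ?qq // leq_subr.
pose m := \sum_(s < k) x`_s.+1 * x`_(k - s).
have zE : z`_k.+1 = diag_mx d * y`_k.+1 + m + x`_k.+1 * diag_mx d.
  by rewrite coefM_ends xd yd (low x y x x).
have wE : w`_k.+1 = diag_mx d * x`_k.+1 + m + y`_k.+1 * diag_mx d.
  by rewrite coefM_ends xd yd (low y x x x).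
pose K := diag_mx g * diag_mx g * z`_k.+1 + z`_k.+1 * (diag_mx g * diag_mx g) : 'M_N.
have expand t : eq_upto k t z -> (z * (t * z))`_k.+1 =
    (diag_mx g * \sum_(s < k) z`_s.+1 * z`_(k - s) +
     \sum_(s < k) z`_s.+1 * (z * z)`_(k - s)) + (K + diag_mx g * t`_k.+1 * diag_mx g).
  move=> tz; have tg : t`_0 = diag_mx g by rewrite tz.
  rewrite coefM_ends (coefM_ends t) zg tg (low t z z z) //.
  rewrite (low z (t * z) z (z * z)) //; last exact: eq_uptoM.
  rewrite (coefM t) big_ord1 tg zg !mulrDr /K -!mulrA.
  by rewrite [LHS](ACl (2*4*(1*5*3))).
have absorb t : t = z \/ t = w -> K + diag_mx g * t`_k.+1 * diag_mx g = K.
  move=> tP; suff ub i j : (diag_mx g * t`_k.+1 * diag_mx g) i j <= K i j.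
    by apply/matrixP => i j; rewrite mxE tropD; apply/max_idPl.
  have gE i' : g 0 i' = d 0 i' * d 0 i' by rewrite mxE.
  have entryl e (M : 'M_N) i' j' : (diag_mx e * M) i' j' = e 0 i' * M i' j' :> trop R.
    by rewrite -mulmxE mul_diag_mx mxE.
  have entryr e (M : 'M_N) i' j' : (M * diag_mx e) i' j' = M i' j' * e 0 j' :> trop R.
    by rewrite -mulmxE mul_mx_diag mxE.
  have addE (P Q : 'M[trop R]_N) : (P + Q) i j = P i j + Q i j by rewrite mxE.
  have KE : K i j = g 0 i * (g 0 i * z`_k.+1 i j) + z`_k.+1 i j * g 0 j * g 0 j.
    by rewrite addE -mulrA [in X in _ + X]mulrA !entryl !entryr.
  rewrite {}KE entryr entryl !gE.
  apply: (swap_absorb (u := x`_k.+1 i j) (v := y`_k.+1 i j) (m := m i j)).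
    by rewrite zE !addE entryl entryr.
  case: tP => ->; first by left.
  by right; rewrite wE !addE entryl entryr.
have wz : eq_upto k w z by move=> s /zw.
have Kz := absorb z (or_introl erefl); have Kw := absorb w (or_intror erefl).
by rewrite (expand z) // (expand w wz) Kz Kw.
Qed.

Lemma swap_words_eq_upto r x y d e : x`_0 = diag_mx d -> y`_0 = diag_mx e ->
  eq_upto r (word_eval x y (swap_words r).1) (word_eval x y (swap_words r).2)
  /\ exists d', (word_eval x y (swap_words r).1)`_0 = diag_mx d'.
Proof.
move=> xd ye; elim: r => [|r IH] /=.
  rewrite /word_eval !big_cons big_nil /= !mulr1; split.
    move=> s; rewrite leqn0 => /eqP->.
    by rewrite !coefM !big_ord1 xd ye -mulmxE diag_mxC.
  by exists (\row_i (d 0 i * e 0 i)); apply: coef0_diagM.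
move: IH; case: swap_words => u v /= [uv [d' ud]].
rewrite !word_eval_subst; move: (word_eval _ _ u) (word_eval _ _ v) uv ud => p q pq pd.
have qd : q`_0 = diag_mx d' by rewrite -pq.
rewrite /word_eval !big_cons big_nil /= !mulr1; split.
  by have := swap_eq_upto pd pq; rewrite !mulrA.
by do ![exact: pd || exact: qd || (eexists; apply: coef0_diagM)
  || apply: coef0_diagM].
Qed.

(** * Matrices whose products are all nonsingular *)

Lemma dominant1_eq1 s : dominant (1 : 'M[trop R]_N) s -> s = 1%g.
Proof.
move=> D; move: (D); rewrite -[X in dominant X _]mulr1.
case/dominantM => s1 [s2 [sE D1 D2 _]].
rewrite (dominant_uniq D1 D) (dominant_uniq D2 D) in sE.
by apply: (mulgI s); rewrite mulg1.
Qed.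

(** The walks attaining the diagonal entries may be taken to be constant: the
    product of these entries is the weight of the dominant permutation, which is
    multiplicative. *)
Lemma dominant_prod_diag (Ms : nat -> 'M[trop R]_N) a b s : (a <= b)%N ->
  (forall t s, dominant (Ms t) s -> s = 1%g) ->
  dominant (\prod_(a <= t < b) Ms t) s ->
  s = 1%g /\
  forall k, (\prod_(a <= t < b) Ms t) k k = \prod_(a <= t < b) Ms t k k.
Proof.
move=> ab id; rewrite -(subnKC ab); elim: (b - a)%N s => [|c IH] s.
  rewrite addn0 big_geq // => /dominant1_eq1 ->; split=> // k.
  by rewrite big_geq // mxE eqxx.
rewrite addnS big_nat_recr ?leq_addr //= => D.
have [s1 [s2 [sE /IH[s1E diag1] /id s2E wE]]] := dominantM D.
have {}sE : s = 1%g by rewrite sE s1E s2E mulg1.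
split=> // k; rewrite big_nat_recr ?leq_addr //= -diag1.
move: D => [nz _]; move: nz; rewrite wE trop_mul_eq0 negb_or => /andP[nz1 nz2].
move: wE nz1 nz2; rewrite sE s1E s2E !perm_weight1.
move=> wE nz1 nz2; apply/esym; move: k.
apply: (trop_prod_le_eq (F := fun k => _ k k * Ms (a + c)%N k k)
  (G := fun k => (_ * Ms (a + c)%N) k k)) => [k|k|].
- exact: trop_mx_ub.
- by rewrite trop_mul_eq0 negb_or (trop_prod_neq0P k nz1) (trop_prod_neq0P k nz2).
- by rewrite wE big_split.
Qed.

(** Optimal walks along u have at most n jumps, and such walks are as good along
    v as along u. *)
Lemma nonsingular_word_le (A B : 'M[trop R]_N) u v i j :
  (forall s, dominant A s -> s = 1%g) -> (forall s, dominant B s -> s = 1%g) ->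
  (exists s, dominant (word_eval A B u) s) ->
  eq_upto n (word_eval (jump_poly A) (jump_poly B) u)
            (word_eval (jump_poly A) (jump_poly B) v) ->
  (word_eval A B u) i j <= (word_eval A B v) i j.
Proof.
move=> idA idB [s dom] uv.
pose letter w t := if nth false w t then A else B.
have evE w : word_eval A B w = \prod_(0 <= t < size w) letter w t.
  by rewrite /word_eval (big_nth false).
have jumpE w : word_eval (jump_poly A) (jump_poly B) w =
    \prod_(0 <= t < size w) jump_poly (letter w t).
  rewrite /word_eval (big_nth false); apply: eq_bigr => t _.
  by rewrite /letter; case: nth.
rewrite [word_eval A B u]evE in dom *.
have [->|nz] := eqVneq ((\prod_(0 <= t < size u) letter u t) i j) 0.
  exact: trop_ge0.
have [x [x0 xm ->]] := walk_exists (leq0n _) nz.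
have closed a b k : (a <= b <= size u)%N ->
    (\prod_(a <= t < b) letter u t) k k <= \prod_(a <= t < b) letter u t k k.
  case/andP=> ab bu; move: dom; rewrite (big_cat_nat (n := b)) //=.
  case/dominantM=> s1 [_ [_ + _ _]]; rewrite (big_cat_nat (n := a)) //=.
  case/dominantM=> _ [s2 [_ _ dom _]].
  have id t s' : dominant (letter u t) s' -> s' = 1%g.
    by rewrite /letter; case: nth; [apply: idA | apply: idB].
  by have [_ ->] := dominant_prod_diag ab id dom.
have [c cN le] := few_jumps x closed.
apply: le_trans le _; rewrite -jumpE uv // x0 xm jumpE evE.
exact: jump_coef_le.
Qed.

End Swap.

(** * Identities of max-plus matrices *)

Section TropIdentity.
Local Open Scope ring_scope.
Variable R : realDomainType.

Lemma dominant_or_singular n (A : 'M[trop R]_n.+1) :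
  (exists s, dominant A s) \/ (forall s, ~ dominant A s).
Proof.
pose dom s := (perm_weight A s != 0) &&
  [forall s', (s' != s) ==> (perm_weight A s' < perm_weight A s)].
have domP s : reflect (dominant A s) (dom s).
  apply: (iffP andP) => -[nz lt]; split=> //.
    by move=> s' neq; move/forallP/(_ s')/implyP: lt; apply.
  by apply/forallP => s'; apply/implyP; apply: lt.
have [s /domP|none] := pickP dom; first by left; exists s.
by right=> s /domP; rewrite none.
Qed.

Lemma word_eval_factored m n (C : 'M[trop R]_(n, m)) D (X Y : 'M_n) w :
  word_eval (C *m D *m X) (C *m D *m Y) w *m (C *m D) =
  C *m word_eval (D *m X *m C) (D *m Y *m C) w *m D.
Proof.
rewrite /word_eval; elim: w => [|c w IH]; first by rewrite !big_nil mul1mx mulmx1.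
rewrite !big_cons -!mulmxE -mulmxA IH.
by case: c; rewrite !mulmxA.
Qed.

Definition is_identity n (u v : seq bool) : Prop :=
  forall A B : 'M[trop R]_n, word_eval A B u = word_eval A B v.

(** For P and Q the values of the words p and q below, either both are
    nonsingular, whence P = Q and any two words of equal length agree at Z P
    and Z Q; or Z, which is a product of high powers of P and of Q, factors
    through dimension n, where the identity of the previous dimension holds. *)
Lemma trop_identity_step n u v : u != v -> size u = size v ->
  is_identity n u v ->
  exists u' v', [/\ u' != v', size u' = size v' & is_identity n.+1 u' v'].
Proof.
move=> uv suv Iuv; set L := (n.+1)`!.
pose a := nseq L true; pose b := nseq L false.
have sab : size a = size b by rewrite !size_nseq.
have L0 : (0 < L)%N by apply: fact_gt0.
have ab : a != b by rewrite /a /b -(prednK L0).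
pose p := word_subst a b (swap_words n).1; pose q := word_subst a b (swap_words n).2.
have spq : size p = size q by rewrite !size_word_subst // size_swap_words.
have pq : p != q.
  by apply: contra (swap_words_neq n) => /eqP/(word_subst_inj sab ab) ->.
pose T := drop_exponent n.
pose pow w := word_subst w w (nseq T true).
pose z := pow p ++ pow q.
pose f w := word_subst (z ++ p) (z ++ q) w ++ z.
have szpq : size (z ++ p) = size (z ++ q) by rewrite !size_cat spq.
have zpq : z ++ p != z ++ q by rewrite eqseq_cat // eqxx.
exists (f u), (f v); split.
- apply: contra uv; rewrite /f eqseq_cat ?size_word_subst ?suv //.
  by case/andP=> /eqP/(word_subst_inj szpq zpq) ->.
- by rewrite !size_cat !size_word_subst ?suv.
move=> A B; pose P : 'M_n.+1 := word_eval A B p; pose Q : 'M_n.+1 := word_eval A B q.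
pose Z : 'M_n.+1 := word_eval A B z.
have fE w : word_eval A B (f w) = word_eval (Z * P) (Z * Q) w * Z.
  by rewrite word_eval_cat word_eval_subst (word_eval_cat _ _ z p) (word_eval_cat _ _ z q).
rewrite !fE.
have powE w : word_eval A B (pow w) = word_eval A B w ^+ T.
  by rewrite word_eval_subst word_eval_nseq.
have ZE : Z = P ^+ T *m Q ^+ T by rewrite /Z word_eval_cat !powE.
have factored : factors_through n Z ->
    word_eval (Z * P) (Z * Q) u * Z = word_eval (Z * P) (Z * Q) v * Z.
  by move=> [C [D ->]]; rewrite -!mulmxE !word_eval_factored Iuv.
have evE w : word_eval A B (word_subst a b w) = word_eval (A ^+ L) (B ^+ L) w.
  by rewrite word_eval_subst !word_eval_nseq.
have [domP|/singular_pow_factors[C [D PE]]] := dominant_or_singular P; last first.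
  apply: factored; exists C, (D *m Q ^+ T); by rewrite mulmxA -PE.
have [domQ|/singular_pow_factors[C [D QE]]] := dominant_or_singular Q; last first.
  apply: factored; exists (P ^+ T *m C), D; by rewrite -mulmxA -QE.
suff -> : P = Q by rewrite !word_eval_diag suv.
have id (M : 'M[trop R]_n.+1) s : dominant (M ^+ L) s -> s = 1%g.
  rewrite -(prednK L0) => /dominantX[s1 _ ->]; rewrite (prednK L0).
  exact: perm_expg_fact.
have [eq _] := swap_words_eq_upto n (jump_poly_coef0 (A ^+ L)) (jump_poly_coef0 (B ^+ L)).
rewrite /P /Q !evE in domP domQ *.
apply/matrixP => i j; apply: le_anti; apply/andP; split.
  by apply: nonsingular_word_le => //; apply: id.
by apply: nonsingular_word_le => // [||s /eq //]; apply: id.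
Qed.

Theorem trop_identity n :
  exists u v, [/\ u != v, size u = size v & is_identity n u v].
Proof.
elim: n => [|n [u [v [uv suv Iuv]]]]; last exact: trop_identity_step uv suv Iuv.
by exists [:: true], [:: false]; split=> // A B; apply/matrixP => -[].
Qed.

End TropIdentity.

(** * From max-plus to supertropical matrices *)

Section Supertropical.
Local Open Scope ring_scope.
Variable R : realType.
Implicit Types x y : supertrop R.

Definition to_trop x : trop R :=
  match x with NInf => None | Tan a | Ghost a => Some a end.

Definition tangible x : bool := if x is Tan _ then true else false.

Lemma to_trop_tangible_inj x y :
  to_trop x = to_trop y -> tangible x = tangible y -> x = y.
Proof. by case: x y => [|a|a] [|b|b] //= [->]. Qed.

Lemma to_tropM x y : to_trop (x * y) = to_trop x * to_trop y.
Proof. by case: x y => [|a|a] [|b|b]. Qed.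

Lemma tangibleM x y : tangible (x * y) = tangible x && tangible y.
Proof. by case: x y => [|a|a] [|b|b]. Qed.

Lemma st_addE x y : x + y =
  if to_trop x < to_trop y then y else if to_trop y < to_trop x then x
  else st_nu x.
Proof.
have [->|[g [a ->]]] := st_mkP x; first by rewrite add0r; case: y.
have [->|[h [b ->]]] := st_mkP y; first by rewrite addr0; case: g.
have toE k c : to_trop (st_mk k c) = Some c by case: k.
have SomeE (c c' : R) : (Some c : trop R) < Some c' = (c < c').
  by rewrite !ltNge.
rewrite !toE !SomeE; apply: etrans (st_add_mk g h a b) _.
by case: ltgtP => //; case: g.
Qed.

Lemma to_tropD x y : to_trop (x + y) = to_trop x + to_trop y.
Proof.
rewrite st_addE tropD; case: ltgtP => // _; by case: x.
Qed.

Lemma tangible_st_nu x : tangible (st_nu x) = false.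
Proof. by case: x. Qed.

Lemma to_trop_sum (I : Type) (r : seq I) (P : pred I) (F : I -> supertrop R) :
  to_trop (\sum_(i <- r | P i) F i) = \sum_(i <- r | P i) to_trop (F i).
Proof. by apply: (big_morph to_trop to_tropD). Qed.

(** A sum is tangible when its maximum is attained only once, at a tangible
    term. *)
Lemma tangible_sumP (I : finType) (F : I -> supertrop R) :
  reflect (exists2 i, tangible (F i) &
             forall j, j != i -> to_trop (F j) < to_trop (F i))
    (tangible (\sum_i F i)).
Proof.
have rest_lt i : tangible (F i) ->
    (forall j, j != i -> to_trop (F j) < to_trop (F i)) ->
    to_trop (\sum_(j | j != i) F j) < to_trop (F i).
  move=> Fi lt; rewrite to_trop_sum; apply: trop_sum_lt => //.
  by case: (F i) Fi.
apply: (iffP idP) => [tan|[i Fi lt]]; last first.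
  by rewrite (bigD1 i) //= st_addE ltNge (ltW (rest_lt i Fi lt)) /= rest_lt.
have [i iE] : exists i, to_trop (\sum_i F i) = to_trop (F i).
  rewrite to_trop_sum; apply: trop_sum_neq0_att.
  by rewrite -to_trop_sum; case: (\sum_i F i) tan.
exists i; move: iE tan; rewrite (bigD1 i) //= st_addE.
all: case: ltgtP => [|lt|eq]; rewrite ?tangible_st_nu //.
- by move=> lt eq; rewrite eq ltxx in lt.
- by move=> lt eq; rewrite eq ltxx in lt.
move=> _ _ j ji; apply: le_lt_trans lt; rewrite to_trop_sum.
exact: (trop_sum_ub (fun j => to_trop (F j))).
Qed.

(** Here [t] stands for the optimal weight of the pairs of walks contributing to
    the entry [x], other than those formed of two copies of a tangible walk. *)
Definition detects_ghost x (t : trop R) : bool :=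
  (t <= to_trop x * to_trop x) &&
  ((t == to_trop x * to_trop x) == ~~ tangible x).

Lemma detects_ghost_sum (I : finType) (x y : I -> supertrop R) (g : I -> trop R) :
  (forall k, detects_ghost (y k) (g k)) ->
  detects_ghost (\sum_k x k * y k)
    (\sum_k to_trop (x k) * to_trop (x k) * g k +
     \sum_(kk : I * I)
       (if (kk.1 == kk.2) && tangible (x kk.1) then 0
        else to_trop (x kk.1) * to_trop (x kk.2)) *
       (to_trop (y kk.1) * to_trop (y kk.2))).
Proof.
move=> det; set z := \sum_k x k * y k; set G1 := \sum_k _ * _; set G2 := \sum_kk _.
pose s k := to_trop (x k * y k).
have zE : to_trop z = \sum_k s k by exact: to_trop_sum.
have s_le k : s k <= to_trop z by rewrite zE trop_sum_ub.
have sE k : s k = to_trop (x k) * to_trop (y k) := to_tropM _ _.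
pose h1 k := to_trop (x k) * to_trop (x k) * g k.
have h1_le k : h1 k <= s k * s k.
  rewrite sE mulrACA; apply: trop_leM => //.
  by case/andP: (det k).
pose h2 kk := (if (kk.1 == kk.2) && tangible (x kk.1) then 0
        else to_trop (x kk.1) * to_trop (x kk.2)) *
       (to_trop (y kk.1) * to_trop (y kk.2)).
have h2_le kk : h2 kk <= s kk.1 * s kk.2.
  rewrite /h2 !sE mulrACA; apply: trop_leM => //.
  by case: ifP.
have G_le : G1 + G2 <= to_trop z * to_trop z.
  rewrite tropD ge_max; apply/andP; split; apply: trop_sum_le => k _.
    by apply: le_trans (h1_le k) _; apply: trop_leM.
  by apply: le_trans (h2_le k) _; apply: trop_leM.
rewrite /detects_ghost G_le /=; apply/eqP; case: (boolP (tangible z)) => /=.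
  case/tangible_sumP => k tan lt.
  have zk : to_trop z = s k.
    apply: le_anti; rewrite s_le andbT zE; apply: trop_sum_le => j _.
    by have [->//|/lt/ltW] := eqVneq j k.
  move: (tan); rewrite tangibleM => /andP[tx ty].
  have sk0 : s k != 0 by rewrite /s; case: (x k * y k) tan.
  have skk0 : s k * s k != 0 by rewrite trop_mul_eq0 negb_or sk0.
  apply/negbTE; rewrite neq_lt; apply/orP; left.
  rewrite zk tropD gt_max; apply/andP; split.
    apply: trop_sum_lt => // j _; have [->|neq] := eqVneq j k; last first.
      by apply: le_lt_trans (h1_le j) _; apply: trop_ltM; apply: lt.
    rewrite sE [ltRHS]mulrACA mulrC [ltRHS]mulrC.
    apply: trop_ltM2r; first by rewrite trop_mul_eq0; case: (x k) tx.
    case/andP: (det k) => le /eqP neq; rewrite lt_neqAle le neq ty.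
    by [].
  apply: trop_sum_lt => // -[i j] _.
  have [/andP[/eqP-> /eqP->]|neq] := boolP ((i == k) && (j == k)).
    by rewrite /= eqxx tx mul0r trop_gt0.
  apply: le_lt_trans (h2_le (i, j)) _ => /=.
  have [eqi|neqi] := eqVneq i k; last first.
    by apply: trop_ltMl; rewrite ?lt // -zk.
  rewrite mulrC; move: neq; rewrite eqi eqxx /= => neqj.
  by apply: trop_ltMl; rewrite ?lt // -zk.
move=> ntan; rewrite eq_le G_le /=.
have [->|z0] := eqVneq (to_trop z) 0; first by rewrite mul0r trop_ge0.
have [k zk] : exists k, to_trop z = s k.
  by rewrite zE; apply: trop_sum_neq0_att; rewrite -zE.
have G1_ge j : h1 j <= G1 + G2 by rewrite tropD le_max trop_sum_ub.
have G2_ge kk : h2 kk <= G1 + G2 by rewrite tropD le_max (trop_sum_ub h2) // orbT.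
have [tan|] := boolP (tangible (x k * y k)); last first.
  rewrite tangibleM negb_and => /orP[nx|ny].
    apply: le_trans (G2_ge (k, k)).
    by rewrite /h2 /= eqxx (negPf nx) zk !sE mulrACA.
  apply: le_trans (G1_ge k); rewrite /h1 zk !sE mulrACA.
  by case/andP: (det k) => _ /eqP; rewrite ny => /eqP->.
have [j /andP[jk le_kj]] : exists j, (j != k) && (s k <= s j).
  apply/existsP; apply: contraR ntan; rewrite negb_exists => /forallP none.
  apply/tangible_sumP; exists k => // j jk.
  by have := none j; rewrite jk /= -ltNge.
apply: le_trans (G2_ge (k, j)).
rewrite /h2 /= eq_sym (negPf jk) /= zk mulrACA -!sE.
exact: trop_leM.
Qed.

Section PairMatrix.
Variable n : nat.
Implicit Types A B : 'M[supertrop R]_n.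
Local Notation node := ('I_n + 'I_n * 'I_n)%type.

(** Steps of two simultaneous walks. The left nodes are those of the pairs of
    walks which have been equal and tangible so far; these pairs are joined into
    one walk, which moves to a right node when its two copies separate or when
    it uses a ghost entry. *)
Definition pair_step A (x y : node) : trop R :=
  match x, y with
  | inl i, inl j => to_trop (A i j) * to_trop (A i j)
  | inl i, inr (j, j') => if (j == j') && tangible (A i j) then 0
                          else to_trop (A i j) * to_trop (A i j')
  | inr _, inl _ => 0
  | inr (i, i'), inr (j, j') => to_trop (A i j) * to_trop (A i' j')
  end.

Definition pair_mx A : 'M[trop R]_#|{: node}| :=
  \matrix_(x, y) pair_step A (enum_val x) (enum_val y).

Definition pair_value A B w (x y : node) : trop R :=
  word_eval (pair_mx A) (pair_mx B) w (enum_rank x) (enum_rank y).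

Lemma pair_value_nil A B (x y : node) : pair_value A B [::] x y = (x == y)%:R.
Proof.
by rewrite /pair_value /word_eval big_nil mxE (inj_eq enum_rank_inj).
Qed.

Lemma pair_value_cons A B c w (x y : node) :
  pair_value A B (c :: w) x y =
  \sum_z pair_step (if c then A else B) x z * pair_value A B w z y.
Proof.
rewrite /pair_value /word_eval big_cons mxE.
rewrite (reindex (@enum_rank node)) /=; last exact/onW_bij/enum_rank_bij.
by apply: eq_bigr => z _; case: c; rewrite mxE !enum_rankK.
Qed.

Lemma pair_value_right A B w i i' j j' :
  pair_value A B w (inr (i, i')) (inr (j, j')) =
  to_trop (word_eval A B w i j) * to_trop (word_eval A B w i' j').
Proof.
elim: w i i' => [|c w IH] i i'.
  rewrite pair_value_nil /word_eval big_nil !mxE.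
  rewrite -[inr _ == _]/((i == j) && (i' == j')).
  have toE (b : bool) : to_trop (b%:R : supertrop R) = b%:R by case: b.
  by rewrite !toE; case: (i == j); rewrite ?mul1r ?mul0r.
rewrite pair_value_cons big_sumType /= big1 ?add0r => [|k _]; last by rewrite mul0r.
rewrite /word_eval !big_cons -/(word_eval A B w) !mxE !to_trop_sum big_distrlr /=.
rewrite pair_bigA; apply: eq_bigr => -[k k'] _ /=.
by rewrite IH !to_tropM mulrACA.
Qed.

Lemma pair_value_left A B w i j :
  detects_ghost (word_eval A B w i j) (pair_value A B w (inl i) (inr (j, j))).
Proof.
elim: w i => [|c w IH] i.
  rewrite pair_value_nil /word_eval big_nil mxE /detects_ghost.
  by case: (i == j).
rewrite pair_value_cons big_sumType /= /word_eval big_cons -/(word_eval A B w).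
have := detects_ghost_sum (fun k => (if c then A else B) i k) IH.
rewrite -mulmxE mxE; congr (detects_ghost _ (_ + _)).
by apply: eq_bigr => -[k k'] _; rewrite pair_value_right.
Qed.

Lemma trop_square_inj (s t : trop R) : s * s = t * t -> s = t.
Proof.
move=> eq; apply/eqP; rewrite eq_le !leNgt; apply/andP; split; apply/negP => lt.
  by have := trop_ltM lt lt; rewrite eq ltxx.
by have := trop_ltM lt lt; rewrite eq ltxx.
Qed.

Lemma supertrop_identity u v :
  is_identity R #|{: node}| u v ->
  forall A B, word_eval A B u = word_eval A B v.
Proof.
move=> Iuv A B; apply/matrixP => i j.
have eqW (x y : node) : pair_value A B u x y = pair_value A B v x y.
  by rewrite /pair_value Iuv.
have eq_trop : to_trop (word_eval A B u i j) = to_trop (word_eval A B v i j).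
  by apply: trop_square_inj; rewrite -!pair_value_right.
apply: to_trop_tangible_inj => //; apply: negb_inj.
have /andP[_ /eqP <-] := pair_value_left A B u i j.
have /andP[_ /eqP <-] := pair_value_left A B v i j.
by rewrite eqW eq_trop.
Qed.

End PairMatrix.

Lemma morphism_word_eval n
    (phi : {multiplicative words bool -> mxmonoid (supertrop R) n})
    (w : seq bool) (w0 : w != [::]) :
  phi (exist _ w w0) =
  word_eval (phi (exist _ [:: true] isT)) (phi (exist _ [:: false] isT)) w
  :> 'M[supertrop R]_n.
Proof.
have letterE c : phi (exist _ [:: c] isT) =
    if c then phi (exist _ [:: true] isT) else phi (exist _ [:: false] isT).
  by case: c.
elim: w w0 => [//|c [|c' w] IH] w0; rewrite /word_eval big_cons.
  by rewrite big_nil mulr1 -letterE; congr (phi _); apply: val_inj.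
have -> : exist _ (c :: c' :: w) w0 =
    ((exist _ [:: c] isT : words bool) * (exist _ (c' :: w) isT : words bool))%g.
  exact: val_inj.
by rewrite gmulfM letterE (IH isT).
Qed.

End Supertropical.

Theorem corollary3p5 (R : realType) (n : nat) (hn : (1 <= n)%N) :
  exists u v : words bool,
    u <> v /\ satisfies_identity (mxmonoid (supertrop R) n) u v.
Proof.
have [u [v [uv suv /supertrop_identity Iuv]]] := trop_identity R #|{: 'I_n + 'I_n * 'I_n}|.
have u0 : u != [::] by case: u v uv suv {Iuv} => [|? ?] [|? ?].
have v0 : v != [::] by case: u v uv suv {Iuv u0} => [|? ?] [|? ?].
exists (exist _ u u0), (exist _ v v0); split.
  by case=> eq; rewrite eq eqxx in uv.
move=> phi; apply: etrans (morphism_word_eval phi u0) _.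
by apply: etrans (Iuv _ _) (esym (morphism_word_eval phi v0)).
Qed.
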